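(* Over binary schemas, $(\mathcal{ALC},\mathrm{AQ})$ has the same expressive power as $(\mathcal{SHI},\mathrm{AQ})$.
   Context: **Queries.** A schema $\mathbf{S}$ is a finite set of relation symbols with arities; it is binary if all its symbols have arity one (concept names) or two (role names). An instance $\mathfrak{D}$ over $\mathbf{S}$ is a finite set of facts $R(a_1,\dots,a_n)$, $R\in\mathbf{S}$, with $a_i$ from a fixed countably infinite set of constants; $\mathrm{adom}(\mathfrak{D})$ is the set of constants occurring in $\mathfrak{D}$. An $n$-ary query over $\mathbf{S}$ maps each $\mathbf{S}$-instance $\mathfrak{D}$ to a set $q(\mathfrak{D})\subseteq \mathrm{adom}(\mathfrak{D})^n$. Two queries over $\mathbf{S}$ are equivalent if they agree on all $\mathbf{S}$-instances. A query language is a set of queries. $\mathcal{Q}_2$ is at least as expressive as $\mathcal{Q}_1$ if every query of $\mathcal{Q}_1$ over some schema $\mathbf{S}$ is equivalent to a query of $\mathcal{Q}_2$ over $\mathbf{S}$; they have the same expressive power if this holds in both directions. AQ is the class of atomic queries $A(x)$ with $A$ a unary relation symbol. **Ontology-mediated queries.** An ontology language $\mathcal{L}$ is a set of first-order (FO) sentences; an $\mathcal{L}$-ontology $\mathcal{O}$ is a finite set of sentences of $\mathcal{L}$, and $\mathrm{sig}(\mathcal{O})$ is the set of its relation symbols. An ontology-mediated query is a triple $(\mathbf{S},\mathcal{O},q)$ with $\mathbf{S}$ a schema (the data schema), $\mathcal{O}$ an ontology and $q$ a query over $\mathbf{S}\cup\mathrm{sig}(\mathcal{O})$. A finite relational structure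 over a schema is a pair $(\mathrm{dom},\mathfrak{D})$ with $\mathrm{dom}$ a finite non-empty set and $\mathfrak{D}$ an instance over the schema with $\mathrm{adom}(\mathfrak{D})\subseteq\mathrm{dom}$. The triple defines the query over $\mathbf{S}$ that maps $\mathfrak{D}$ to the set of certain answers: all $\mathbf{a}\in\mathrm{adom}(\mathfrak{D})^n$ such that $\mathbf{a}\in q(\mathfrak{D}')$ for every finite relational structure $(\mathrm{dom},\mathfrak{D}')$ over $\mathbf{S}\cup\mathrm{sig}(\mathcal{O})$ that satisfies $\mathcal{O}$ and has $\mathfrak{D}\subseteq\mathfrak{D}'$. $(\mathcal{L},\mathcal{Q})$ denotes the query language of all queries defined by ontology-mediated queries $(\mathbf{S},\mathcal{O},q)$ with $\mathcal{O}$ an $\mathcal{L}$-ontology and $q\in\mathcal{Q}$. **Description logics.** $\mathcal{ALC}$-concepts: $C,D::=A\mid\top\mid\bot\mid\neg C\mid C\sqcap D\mid C\sqcup D\mid\exists R.C\mid\forall R.C$ with $A$ a concept name, $R$ a role name. They translate to FO formulas with one free variable: $A^*(x)=A(x)$; $\top,\bot$ and Booleans as expected; $(\exists R.C)^*(x)=\exists y(R(x,y)\wedge C^*(y))$; $(\forall R.C)^*(x)=\forall y(R(x,y)\to C^*(y))$. An $\mathcal{ALC}$-ontology is a finite set of concept inclusions $C\sqsubseteq D$, read as $\forall x(C^*(x)\to D^*(x))$. $\mathcal{SHI}$ is the extension of $\mathcal{ALC}$ whose ontologies may additionally contain statements that a role name is interpreted as a transitive relation, role inclusions $\forall xy(R(x,y)\to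 S(x,y))$ between role names, and statements $\forall xy(R(x,y)\leftrightarrow S(y,x))$ that a role name is the inverse of another. *)

(* Defs.v *)
From Stdlib Require List.
From mathcomp Require Import all_boot.
From mathcomp Require Import finmap.

Set Implicit Arguments.
Unset Strict Implicit.
Unset Printing Implicit Defensive.

Local Open Scope fset_scope.

Definition const := nat.

(** A relation symbol is a pair (name, arity), so that there is an infinite
    supply of symbols of every arity. *)
Definition symbol : Type := (nat * nat)%type.
Definition arity (R : symbol) : nat := R.2.

Definition schema := {fset symbol}.

Definition binary (S : schema) : Prop :=
  forall R, R \in S -> arity R = 1 \/ arity R = 2.

Definition fact : Type := {R : symbol & (arity R).-tuple const}.

Definition Fact (R : symbol) (t : (arity R).-tuple const) : fact :=
  Tagged (fun R => (arity R).-tuple const) t.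

Record instance (S : schema) := Instance {
  facts :> {fset fact};
  _ : [fset tag f | f in facts] `<=` S
}.

Definition adom (S : schema) (D : instance S) : {fset const} :=
  \bigcup_(f <- facts D) [fset c | c in val (tagged f)].

Record structure (S : schema) := Structure {
  dom : {fset const};
  inst : instance S;
  dom_neq0 : dom != fset0;
  adom_sub_dom : adom inst `<=` dom
}.

Record query (S : schema) (n : nat) := Query {
  answers :> instance S -> n.-tuple const -> Prop;
  answers_adom : forall D a, answers D a -> {subset a <= adom D}
}.

Definition equivalent (S : schema) (n : nat) (q1 q2 : query S n) : Prop :=
  forall D a, q1 D a <-> q2 D a.

Definition query_language := forall (S : schema) (n : nat), query S n -> Prop.

(** [K] is the class of schemas to which the comparison is restricted. *)
Definition at_least_as_expressive (K : schema -> Prop)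
    (Q2 Q1 : query_language) : Prop :=
  forall S n (q1 : query S n), K S -> Q1 S n q1 ->
    exists q2 : query S n, Q2 S n q2 /\ equivalent q1 q2.

Definition same_expressive_power (K : schema -> Prop)
    (Q1 Q2 : query_language) : Prop :=
  at_least_as_expressive K Q1 Q2 /\ at_least_as_expressive K Q2 Q1.

Inductive formula : Type :=
| FRel (R : symbol) (v : (arity R).-tuple nat)
| FEq (x y : nat)
| FTrue
| FFalse
| FNot (phi : formula)
| FAnd (phi psi : formula)
| FOr (phi psi : formula)
| FImp (phi psi : formula)
| FAll (x : nat) (phi : formula)
| FEx (x : nat) (phi : formula).

Definition FIff (phi psi : formula) : formula :=
  FAnd (FImp phi psi) (FImp psi phi).

Fixpoint fv (phi : formula) : {fset nat} :=
  match phi with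
  | FRel _ v => [fset x | x in val v]
  | FEq x y => [fset x; y]
  | FTrue | FFalse => fset0
  | FNot phi => fv phi
  | FAnd phi psi | FOr phi psi | FImp phi psi => fv phi `|` fv psi
  | FAll x phi | FEx x phi => fv phi `\ x
  end.

Fixpoint fsig (phi : formula) : schema :=
  match phi with
  | FRel R _ => [fset R]
  | FEq _ _ | FTrue | FFalse => fset0
  | FNot phi => fsig phi
  | FAnd phi psi | FOr phi psi | FImp phi psi => fsig phi `|` fsig psi
  | FAll _ phi | FEx _ phi => fsig phi
  end.

Definition update (e : nat -> const) (x : nat) (c : const) : nat -> const :=
  fun y => if y == x then c else e y.

Fixpoint holds (S : schema) (M : structure S) (e : nat -> const)
    (phi : formula) : Prop :=
  match phi with
  | FRel R v => Fact (map_tuple e v) \in facts (inst M)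
  | FEq x y => e x = e y
  | FTrue => True
  | FFalse => False
  | FNot phi => ~ holds M e phi
  | FAnd phi psi => holds M e phi /\ holds M e psi
  | FOr phi psi => holds M e phi \/ holds M e psi
  | FImp phi psi => holds M e phi -> holds M e psi
  | FAll x phi => forall c, c \in dom M -> holds M (update e x c) phi
  | FEx x phi => exists c, c \in dom M /\ holds M (update e x c) phi
  end.

Record sentence := Sentence {
  sform :> formula;
  _ : fv sform == fset0
}.

Definition ontology_language := sentence -> Prop.

(** A list stands for the finite set of its members. *)
Definition ontology := seq sentence.

Definition ontology_in (L : ontology_language) (O : ontology) : Prop :=
  List.Forall L O.

Definition sig (O : ontology) : schema := \bigcup_(phi <- O) fsig phi.

(** The choice of the assignment [e] is irrelevant, as sentences are closed. *)
Definition satisfies (S : schema) (M : structure S) (O : ontology) : Prop :=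
  List.Forall
    (fun phi : sentence =>
       forall e, (forall x, e x \in dom M) -> holds M e phi) O.

Definition certain (S : schema) (O : ontology) (n : nat)
    (q : query (S `|` sig O) n) (D : instance S) (a : n.-tuple const) : Prop :=
  {subset a <= adom D} /\
  forall M : structure (S `|` sig O),
    satisfies M O -> facts D `<=` facts (inst M) -> q (inst M) a.

Lemma certain_adom (S : schema) (O : ontology) (n : nat)
    (q : query (S `|` sig O) n) D a : certain q D a -> {subset a <= adom D}.
Proof. by case. Qed.

Definition omq (S : schema) (O : ontology) (n : nat)
    (q : query (S `|` sig O) n) : query S n :=
  Query (@certain_adom S O n q).

Inductive omq_language (L : ontology_language) (Q : query_language)
    (S : schema) (n : nat) : query S n -> Prop :=
| Omq (O : ontology) (q : query (S `|` sig O) n) :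
    ontology_in L O -> Q (S `|` sig O) n q -> omq_language L Q (omq q).

Definition concept_name (A : nat) : symbol := (A, 1).
Definition role_name (R : nat) : symbol := (R, 2).

Definition atomic_ans (S : schema) (A : nat) (D : instance S)
    (a : 1.-tuple const) : Prop :=
  @Fact (concept_name A) a \in facts D.

Lemma atomic_adom (S : schema) (A : nat) (D : instance S) a :
  atomic_ans A D a -> {subset a <= adom D}.
Proof.
move=> inD x xa; apply/bigfcupP; exists (@Fact (concept_name A) a).
  by rewrite inD.
by rewrite inE.
Qed.

Definition atomic (S : schema) (A : nat) : query S 1 :=
  Query (@atomic_adom S A).

Inductive AQ (S : schema) : forall n : nat, query S n -> Prop :=
| AQ_atomic (A : nat) : concept_name A \in S -> AQ (atomic S A).

Inductive concept : Type :=
| CName (A : nat)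
| CTop
| CBot
| CNot (C : concept)
| CAnd (C D : concept)
| COr (C D : concept)
| CEx (R : nat) (C : concept)
| CAll (R : nat) (C : concept).

Definition concept_atom (A x : nat) : formula :=
  @FRel (concept_name A) [tuple x].
Definition role_atom (R x y : nat) : formula :=
  @FRel (role_name R) [tuple x; y].

(** [tr C x] is the formula C*(x); the bound variable y is [x.+1]. *)
Fixpoint tr (C : concept) (x : nat) : formula :=
  match C with
  | CName A => concept_atom A x
  | CTop => FTrue
  | CBot => FFalse
  | CNot C => FNot (tr C x)
  | CAnd C D => FAnd (tr C x) (tr D x)
  | COr C D => FOr (tr C x) (tr D x)
  | CEx R C => FEx x.+1 (FAnd (role_atom R x x.+1) (tr C x.+1))
  | CAll R C => FAll x.+1 (FImp (role_atom R x x.+1) (tr C x.+1))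
  end.

Lemma fv_tr (C : concept) (x : nat) : fv (tr C x) `<=` [fset x].
Proof.
elim: C x => [A|||C IHC|C IHC D IHD|C IHC D IHD|R C IHC|R C IHC] x //=;
  rewrite ?fsub0set //.
- by apply/fsubsetP => y; rewrite !inE orbF.
- by rewrite fsubUset IHC IHD.
- by rewrite fsubUset IHC IHD.
- apply/fsubsetP => y; rewrite !inE => /andP[/negPf yx].
  by rewrite yx !orbF => /orP[//|/(fsubsetP (IHC _))]; rewrite inE yx.
- apply/fsubsetP => y; rewrite !inE => /andP[/negPf yx].
  by rewrite yx !orbF => /orP[//|/(fsubsetP (IHC _))]; rewrite inE yx.
Qed.

Definition ci_formula (C D : concept) : formula :=
  FAll 0 (FImp (tr C 0) (tr D 0)).

Definition transitive_formula (R : nat) : formula :=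
  FAll 0 (FAll 1 (FAll 2
    (FImp (FAnd (role_atom R 0 1) (role_atom R 1 2)) (role_atom R 0 2)))).

Definition role_inclusion_formula (R S : nat) : formula :=
  FAll 0 (FAll 1 (FImp (role_atom R 0 1) (role_atom S 0 1))).

Definition inverse_formula (R S : nat) : formula :=
  FAll 0 (FAll 1 (FIff (role_atom R 0 1) (role_atom S 1 0))).

Lemma ci_closed (C D : concept) : fv (ci_formula C D) == fset0.
Proof. by rewrite /= fsetD_eq0 fsubUset !fv_tr. Qed.

Lemma transitive_closed (R : nat) : fv (transitive_formula R) == fset0.
Proof.
by apply/eqP/fsetP => -[|[|[|x]]]; rewrite /= !inE.
Qed.

Lemma role_inclusion_closed (R S : nat) :
  fv (role_inclusion_formula R S) == fset0.
Proof.
by apply/eqP/fsetP => -[|[|[|x]]]; rewrite /= !inE.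
Qed.

Lemma inverse_closed (R S : nat) : fv (inverse_formula R S) == fset0.
Proof.
by apply/eqP/fsetP => -[|[|[|x]]]; rewrite /= !inE.
Qed.

Definition ci (C D : concept) : sentence := Sentence (ci_closed C D).
Definition transitive_role (R : nat) : sentence :=
  Sentence (transitive_closed R).
Definition role_inclusion (R S : nat) : sentence :=
  Sentence (role_inclusion_closed R S).
Definition inverse_roles (R S : nat) : sentence :=
  Sentence (inverse_closed R S).

Inductive ALC : ontology_language :=
| ALC_ci (C D : concept) : ALC (ci C D).

Inductive SHI : ontology_language :=
| SHI_ci (C D : concept) : SHI (ci C D)
| SHI_trans (R : nat) : SHI (transitive_role R)
| SHI_sub (R S : nat) : SHI (role_inclusion R S)
| SHI_inv (R S : nat) : SHI (inverse_roles R S).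

(* Main.v *)
(** Only the inclusion of (SHI, AQ) in (ALC, AQ) is substantial. Record at every
    element of a finite model of the SHI-ontology O its type: which
    subconcepts C of O (and of the query) hold there, and which existential
    restrictions of them along roles and inverse roles. The ALC-ontology has a
    fresh concept name for every type; it says that every element carries a type
    realized in a finite model of O, that the types at a data fact A(a) or
    R(a,b) are realized jointly by such a fact in a finite model of O, and that
    a type realized with the queried name implies a fresh goal name. Conversely,
    a finite model of the ALC-ontology gives a model of O on the constants of
    the data together with one element per type, in the style of a filtration:
    R holds between all pairs whose types are compatible with an R-edge. This
    makes the role axioms of O hold automatically, and the recorded existential
    restrictions along (inverse) roles make every element satisfy exactly the
    concepts of its type. *)

From HB Require Import structures.
From Stdlib Require List.
From mathcomp Require Import all_boot.
From mathcomp Require Import finmap boolp.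
Require Import Defs.

Set Implicit Arguments.
Unset Strict Implicit.
Unset Printing Implicit Defensive.

Local Open Scope fset_scope.

HB.instance Definition _ := gen_eqMixin concept.

(** * Semantics of concepts and role axioms *)

Definition conc (S : schema) (D : instance S) (A : nat) (c : const) : Prop :=
  @Fact (concept_name A) [tuple c] \in facts D.

Definition role (S : schema) (D : instance S) (R : nat) (c d : const) : Prop :=
  @Fact (role_name R) [tuple c; d] \in facts D.

(** Concepts are evaluated directly, without assignments; [holds_tr] ties this to the first-order
    translation. *)
Fixpoint sat (S : schema) (M : structure S) (C : concept) (c : const) : Prop :=
  match C with
  | CName A => conc (inst M) A c
  | CTop => True
  | CBot => False
  | CNot C => ~ sat M C c
  | CAnd C D => sat M C c /\ sat M D c
  | COr C D => sat M C c \/ sat M D c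
  | CEx R C => exists d, d \in dom M /\ role (inst M) R c d /\ sat M C d
  | CAll R C => forall d, d \in dom M -> role (inst M) R c d -> sat M C d
  end.

Lemma update_eq e x c : update e x c x = c.
Proof. by rewrite /update eqxx. Qed.

Lemma update_succ e x c : update e x.+1 c x = e x.
Proof. by rewrite /update ltn_eqF. Qed.

Lemma fact_tag (S : schema) (D : instance S) f : f \in facts D -> tag f \in S.
Proof. by case: D => F FS /= fF; apply/(fsubsetP FS)/in_imfset. Qed.

Section Semantics.
Variables (S : schema) (M : structure S).

Lemma fact_dom f c :
  f \in facts (inst M) -> c \in val (tagged f) -> c \in dom M.
Proof.
move=> fM cf; apply: (fsubsetP (adom_sub_dom M)).
by apply/bigfcupP; exists f; rewrite ?fM ?inE.
Qed.

Lemma conc_dom A c : conc (inst M) A c -> c \in dom M.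
Proof. by move/fact_dom; apply; rewrite inE. Qed.

Lemma role_dom R c d : role (inst M) R c d -> c \in dom M /\ d \in dom M.
Proof. by move/fact_dom=> h; split; apply: h; rewrite !inE eqxx ?orbT. Qed.

Lemma holds_concept e A x :
  holds M e (concept_atom A x) <-> conc (inst M) A (e x).
Proof.
rewrite /= /conc; suff -> : map_tuple e [tuple x] = [tuple e x] by [].
exact/val_inj.
Qed.

Lemma holds_role e R x y :
  holds M e (role_atom R x y) <-> role (inst M) R (e x) (e y).
Proof.
rewrite /= /role; suff -> : map_tuple e [tuple x; y] = [tuple e x; e y] by [].
exact/val_inj.
Qed.

Lemma holds_tr C e x : holds M e (tr C x) <-> sat M C (e x).
Proof.
elim: C e x => [A|||C IHC|C IHC D IHD|C IHC D IHD|R C IHC|R C IHC] e x //.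
- exact: holds_concept.
- by rewrite /= IHC.
- by rewrite /= IHC IHD.
- by rewrite /= IHC IHD.
- split=> -[d [dM [h1 h2]]]; exists d; split=> //; split.
  + by have := (holds_role _ _ _ _).1 h1; rewrite update_eq update_succ.
  + by have := (IHC _ _).1 h2; rewrite update_eq.
  + by apply/holds_role; rewrite update_eq update_succ.
  + by apply/IHC; rewrite update_eq.
- split=> h d dM h1.
  + rewrite -(update_eq e x.+1 d); apply/IHC/h => //.
    by apply/holds_role; rewrite update_eq update_succ.
  + apply/IHC; rewrite update_eq; apply: h => //.
    by have := (holds_role _ _ _ _).1 h1; rewrite update_eq update_succ.
Qed.

Definition valid (phi : formula) : Prop :=
  forall e, (forall x, e x \in dom M) -> holds M e phi.

Lemma dom_assignment : exists e : nat -> const, forall x, e x \in dom M.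
Proof. by have /fset0Pn[c cM] := dom_neq0 M; exists (fun=> c). Qed.

Lemma valid_ci C D :
  valid (ci C D) <-> forall c, c \in dom M -> sat M C c -> sat M D c.
Proof.
have [e0 he0] := dom_assignment; split=> [/(_ _ he0) h c cM|h e _ c cM].
  move=> cC; rewrite -(update_eq e0 0 c); apply/holds_tr/(h c cM)/holds_tr.
  by rewrite update_eq.
move=> /holds_tr; rewrite update_eq => /(h c cM) cD; apply/holds_tr.
by rewrite update_eq.
Qed.

Lemma valid_trans R :
  valid (transitive_role R) <->
  forall c d k, role (inst M) R c d -> role (inst M) R d k ->
    role (inst M) R c k.
Proof.
have [e0 he0] := dom_assignment; split=> [/(_ _ he0) h c d k cd dk|h e _].
  have [cM dM] := role_dom cd; have [_ kM] := role_dom dk.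
  apply: (holds_role _ R 0 2).1 (h c cM d dM k kM _).
  by split; apply/holds_role.
move=> c _ d _ k _ [cd dk]; apply/holds_role.
exact: h ((holds_role _ R 0 1).1 cd) ((holds_role _ R 1 2).1 dk).
Qed.

Lemma valid_sub R R' :
  valid (role_inclusion R R') <->
  forall c d, role (inst M) R c d -> role (inst M) R' c d.
Proof.
have [e0 he0] := dom_assignment; split=> [/(_ _ he0) h c d cd|h e _].
  have [cM dM] := role_dom cd.
  by apply: (holds_role _ R' 0 1).1 (h c cM d dM _); apply/holds_role.
move=> c _ d _ cd; apply/holds_role.
exact: h ((holds_role _ R 0 1).1 cd).
Qed.

Lemma valid_inv R R' :
  valid (inverse_roles R R') <->
  forall c d, role (inst M) R c d <-> role (inst M) R' d c.
Proof.
have [e0 he0] := dom_assignment; split=> [/(_ _ he0) h c d|h e _].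
  split=> cd; have [cM dM] := role_dom cd.
    have [+ _] := h c cM d dM => h1.
    by apply: (holds_role _ R' 1 0).1 (h1 _); apply/holds_role.
  have [_ +] := h c dM d cM => h1.
  by apply: (holds_role _ R 0 1).1 (h1 _); apply/holds_role.
move=> c _ d _; split=> cd; apply/holds_role.
  exact: (h _ _).1 ((holds_role _ R 0 1).1 cd).
exact: (h _ _).2 ((holds_role _ R' 1 0).1 cd).
Qed.

Lemma satisfiesP O : satisfies M O <-> forall phi, List.In phi O -> valid phi.
Proof. exact: List.Forall_forall. Qed.

End Semantics.

(** Only finitely many facts exist over a finite schema and finitely many constants, so any
    predicate, decidable or not, cuts out an instance. *)
Lemma structure_exists (S : schema) (X : {fset const}) (P : fact -> Prop) :
  X != fset0 ->
  exists M : structure S, dom M = X /\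
    forall f, f \in facts (inst M) <->
      [/\ tag f \in S, {subset val (tagged f) <= X} & P f].
Proof.
move=> X0.
pose U : {fset fact} := \bigcup_(R <- S)
  [fset Fact (map_tuple val t) | t in {: (arity R).-tuple X}].
pose F := [fset f in U | `[< P f >]].
have UP f : f \in U <-> tag f \in S /\ {subset val (tagged f) <= X}.
  split.
    case/bigfcupP => R; rewrite andbT => RS /imfsetP[/= t _ ->]; split=> //= c.
    by case/mapP => d _ ->; apply: valP.
  case: f => R t /= [RS tX]; apply/bigfcupP; exists R; rewrite ?RS //.
  (* [c0] is only the default of [insubd], never reached because all entries of [t] lie in [X]. *)
  have /fset0Pn[c0 c0X] := X0.
  apply/imfsetP => /=; exists (map_tuple (insubd [` c0X]) t) => //.
  congr Tagged; apply/val_inj => /=; rewrite -map_comp.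
  by rewrite map_id_in // => c /tX cX /=; rewrite insubdK.
have FP f : f \in F <->
    [/\ tag f \in S, {subset val (tagged f) <= X} & P f].
  rewrite /F !inE /=; split.
    by case/andP=> /UP[? ?] /asboolP.
  by case=> ? ? ?; apply/andP; split; [apply/UP|apply/asboolP].
have FS : [fset tag f | f in F] `<=` S.
  by apply/fsubsetP => R /imfsetP[/= f /FP[? _ _] ->].
have FX : adom (Instance FS) `<=` X.
  apply/fsubsetP => c /bigfcupP[f]; rewrite andbT => /FP[_ fX _].
  by rewrite inE => /fX.
by exists (Structure X0 FX).
Qed.

(** [CNot C] joins the list for [CAll R C] because types record existential restrictions only, and a
    universal one fails through a successor in [CNot C]. *)
Fixpoint subconcepts (C : concept) : seq concept :=
  C :: match C with
       | CName _ | CTop | CBot => [::]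
       | CNot C | CEx _ C => subconcepts C
       | CAnd C D | COr C D => subconcepts C ++ subconcepts D
       | CAll _ C => CNot C :: subconcepts C
       end.

Lemma mem_subconcepts C : C \in subconcepts C.
Proof. by case: C => *; rewrite inE eqxx. Qed.

(** * Types and their compatibility along roles *)

Section Types.
Variables (Sg : schema) (O : ontology) (cl : seq concept).

Definition model (M : structure Sg) : Prop := satisfies M O.

(* The pair [(b, R)] encodes [R] if [b = false] and the inverse of [R] if
   [b = true]. *)
Definition rel (M : structure Sg) (r : bool * nat) (c d : const) : Prop :=
  if r.1 then role (inst M) r.2 d c else role (inst M) r.2 c d.

Definition exrel (M : structure Sg) (r : bool * nat) (C : concept)
    (c : const) : Prop :=
  exists d, rel M r c d /\ sat M C d.

Definition passes (M : structure Sg) (t : option (bool * nat) * concept) c :=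
  if t.1 is Some r then exrel M r t.2 c else sat M t.2 c.

(** Arities are dropped, so a number outside this list is fresh as a concept name and as a role
    name. *)
Definition names : seq nat := [seq R.1 | R <- enum_fset Sg].

Definition tests : seq (option (bool * nat) * concept) :=
  [seq (None, C) | C <- cl] ++
  [seq (Some r, C) | r <- [seq (b, R) | b <- [:: false; true], R <- names],
                     C <- cl].

(** As Boolean vectors, types form a finite type: an ontology can list them and [pickle] numbers
    them. *)
Definition ctype := (size tests).-tuple bool.

Definition typeof (M : structure Sg) (c : const) : ctype :=
  map_tuple (fun t => `[< passes M t c >]) (in_tuple tests).

Lemma mem_names (R : symbol) : R \in Sg -> R.1 \in names.
Proof. by move=> RS; apply: map_f. Qed.

Lemma typeof_eq M c M' c' t :
  typeof M c = typeof M' c' -> t \in tests -> passes M t c <-> passes M' t c'.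
Proof.
by move/(congr1 val) => /= /eq_in_map h /h; apply: asbool_eq_equiv.
Qed.

Lemma typeof_sat M c M' c' C :
  typeof M c = typeof M' c' -> C \in cl -> sat M C c <-> sat M' C c'.
Proof.
move=> e Ccl; apply: (typeof_eq (t := (None, C)) e).
by rewrite mem_cat map_f.
Qed.

Lemma typeof_exrel M c M' c' r C :
  typeof M c = typeof M' c' -> r.2 \in names -> C \in cl ->
  exrel M r C c <-> exrel M' r C c'.
Proof.
move=> e rn Ccl; apply: (typeof_eq (t := (Some r, C)) e).
rewrite mem_cat; apply/orP; right; apply/allpairsP; exists (r, C); split=> //.
apply/allpairsP; exists r; case: r rn => -[] R Rn; split=> //=.
Qed.

(** Semantic consequence in the models of [O] stands in for the syntactic role hierarchy, as
    [transitive] does for transitivity statements. *)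
Definition entails (r r' : bool * nat) : Prop :=
  forall M, model M -> forall c d, rel M r c d -> rel M r' c d.

Definition transitive (r : bool * nat) : Prop :=
  forall M, model M -> forall c d k, rel M r c d -> rel M r d k -> rel M r c k.

Definition pointed := (structure Sg * const)%type.

(* The largest relation between types that may serve as an [r]-edge: the
   second half lets existential restrictions travel along transitive
   super-roles of [r]. *)
Definition compat (r : bool * nat) (x y : pointed) : Prop :=
  forall r' C, r'.2 \in names -> entails r r' -> C \in cl ->
    (sat y.1 C y.2 -> exrel x.1 r' C x.2) /\
    (transitive r' -> exrel y.1 r' C y.2 -> exrel x.1 r' C x.2).

(** With both directions demanded, an inverse axiom merely swaps the two halves. *)
Definition link (R : nat) (x y : pointed) : Prop :=
  compat (false, R) x y /\ compat (true, R) y x.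

(** The endpoint of a real edge is itself the witness; along a transitive super-role the edge is put
    in front of the edge to the old witness. *)
Lemma compat_rel M r c d : model M -> rel M r c d -> compat r (M, c) (M, d).
Proof.
move=> MO cd r' C _ rr' _ /=; split=> [dC|tr [k [dk kC]]].
  by exists d; split=> //; apply: rr'.
by exists k; split=> //; apply: tr dk => //; apply: rr'.
Qed.

(** Compatibility consults only tests that types record, so an edge found in one model links points
    of equal types in others. *)
Lemma compat_typeof r x y x' y' :
  typeof x.1 x.2 = typeof x'.1 x'.2 -> typeof y.1 y.2 = typeof y'.1 y'.2 ->
  compat r x y -> compat r x' y'.
Proof.
move=> ex ey xy r' C rn rr' Ccl; have [h1 h2] := xy r' C rn rr' Ccl; split.
  by move/(typeof_sat ey Ccl)/h1/(typeof_exrel ex rn Ccl).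
by move=> tr /(typeof_exrel ey rn Ccl)/(h2 tr)/(typeof_exrel ex rn Ccl).
Qed.

Lemma compat_entails r r' x y : entails r r' -> compat r x y -> compat r' x y.
Proof.
move=> rr' xy r2 C rn r'r2; apply: xy => // M MO c d /(rr' _ MO).
exact: r'r2.
Qed.

(** A concept at [z] becomes an [r]-restriction at [y], which transitivity of [r] carries to [x],
    where [r] is weakened to [r']. If [r'] is transitive, restrictions at [z] travel in two
    steps. *)
Lemma compat_trans r x y z :
  model x.1 -> r.2 \in names -> transitive r ->
  compat r x y -> compat r y z -> compat r x z.
Proof.
move=> xO rn tr xy yz r' C r'n rr' Ccl.
have [_ xy_r] := xy r C rn (fun _ _ _ _ => id) Ccl.
have [yz_r _] := yz r C rn (fun _ _ _ _ => id) Ccl.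
have [_ xy_r'] := xy r' C r'n rr' Ccl.
have [_ yz_r'] := yz r' C r'n rr' Ccl.
split=> [zC|tr' /(yz_r' tr')/(xy_r' tr') //].
have [d [xd dC]] := xy_r tr (yz_r zC).
by exists d; split=> //; apply: rr'.
Qed.

Lemma link_role M R c d :
  model M -> role (inst M) R c d -> link R (M, c) (M, d).
Proof. by move=> MO cd; split; apply: compat_rel. Qed.

Lemma link_typeof R x y x' y' :
  typeof x.1 x.2 = typeof x'.1 x'.2 -> typeof y.1 y.2 = typeof y'.1 y'.2 ->
  link R x y -> link R x' y'.
Proof.
by move=> ex ey [xy yx]; split; [move: xy|move: yx]; apply: compat_typeof.
Qed.

Definition shi_axiom (phi : sentence) : Prop :=
  [\/ exists C D, [/\ phi = ci C D, {subset subconcepts C <= cl} &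
                     {subset subconcepts D <= cl}],
      exists R, phi = transitive_role R,
      exists R R', phi = role_inclusion R R' |
      exists R R', phi = inverse_roles R R'].

(** * The filtration and its truth lemma *)

Section Filtration.
Variables (D : {fset fact}) (pt : const -> pointed) (N : structure Sg).

(** Data facts are added outright because a type does not determine names outside [cl]. *)
Definition filtration_fact (f : fact) : Prop :=
  f \in D \/
  match val (tagged f) with
  | [:: c] => conc (inst (pt c).1) (tag f).1 (pt c).2
  | [:: c; d] => link (tag f).1 (pt c) (pt d)
  | _ => False
  end.

Hypothesis OSg : forall phi, List.In phi O -> fsig phi `<=` Sg.
Hypothesis Oshi : forall phi, List.In phi O -> shi_axiom phi.
Hypothesis pt_model : forall c, model (pt c).1 /\ (pt c).2 \in dom (pt c).1.
Hypothesis pt_full : forall M c, model M -> c \in dom M ->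
  exists2 u, u \in dom N & typeof (pt u).1 (pt u).2 = typeof M c.
Hypothesis D_conc : forall A c, @Fact (concept_name A) [tuple c] \in D ->
  exists M u, [/\ model M, typeof M u = typeof (pt c).1 (pt c).2 &
                  conc (inst M) A u].
Hypothesis D_role : forall R c d, @Fact (role_name R) [tuple c; d] \in D ->
  exists M u v, [/\ model M, typeof M u = typeof (pt c).1 (pt c).2,
                    typeof M v = typeof (pt d).1 (pt d).2 &
                    role (inst M) R u v].
Hypothesis NP : forall f, f \in facts (inst N) <->
  [/\ tag f \in Sg, {subset val (tagged f) <= dom N} & filtration_fact f].

Lemma filtration_conc A c : CName A \in cl -> c \in dom N ->
  conc (inst N) A c <-> conc (inst (pt c).1) A (pt c).2.
Proof.
move=> Acl cN; split=> [/NP[_ _ [/D_conc[M [u [_ e uA]]]|//]]|cA].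
  exact: (typeof_sat e Acl).1 uA.
apply/NP; split; [exact: (fact_tag cA)| |by right].
by move=> d; rewrite !inE => /eqP ->.
Qed.

(** [D_role] realizes each data edge between points of the right types, so the data adds no edge
    beyond the links. *)
Lemma filtration_role R c d :
  role (inst N) R c d <->
  [/\ role_name R \in Sg, c \in dom N, d \in dom N & link R (pt c) (pt d)].
Proof.
split=> [cd|[RSg cN dN l]].
  have [cN dN] := role_dom cd; split=> //; first exact: (fact_tag cd).
  case/NP: (cd) => _ _ [/D_role[M [u [v [MO eu ev uv]]]]|//].
  by apply: link_typeof (link_role MO uv) => /=.
apply/NP; split; [by []| |by right].
by move=> k; rewrite !inE => /orP[] /eqP ->.
Qed.

(** Induction on [C]. A link into [C] yields a witness in the model of [pt c] by compatibility;
    conversely, [pt_full] represents the type of such a witness in [N], and links depend on types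
    only. *)
Lemma filtration_sat C c : {subset subconcepts C <= cl} -> c \in dom N ->
  sat N C c <-> sat (pt c).1 C (pt c).2.
Proof.
elim: C c => [A|||C IHC|C IHC C' IHC'|C IHC C' IHC'|R C IHC|R C IHC] c sub cN
  //.
- by apply: filtration_conc => //; apply: sub; rewrite inE.
- by rewrite /= IHC // => k kC; apply: sub; rewrite inE kC orbT.
- rewrite /= IHC ?IHC' // => k kC; apply: sub.
    by rewrite /= inE mem_cat kC !orbT.
  by rewrite /= inE mem_cat kC !orbT.
- rewrite /= IHC ?IHC' // => k kC; apply: sub.
    by rewrite /= inE mem_cat kC !orbT.
  by rewrite /= inE mem_cat kC !orbT.
- have {}IHC d : d \in dom N -> sat N C d <-> sat (pt d).1 C (pt d).2.
    by apply: IHC => k kC; apply: sub; rewrite inE kC orbT.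
  have Ccl : C \in cl by apply: sub; rewrite /= inE mem_subconcepts orbT.
  have [MO _] := pt_model c.
  split=> [[d [dN [/filtration_role[RSg _ _ [l _]] /(IHC _ dN) dC]]]|].
    have [h _] := l (false, R) C (mem_names RSg) (fun _ _ _ _ => id) Ccl.
    have [k [ck kC]] := h dC.
    by exists k; split=> //; have [] := role_dom ck.
  move=> [d [dM [cd dC]]]; have [u uN eu] := pt_full MO dM.
  exists u; split=> //; split; last by apply/IHC => //; apply/(typeof_sat eu).
  apply/filtration_role; split=> //; first exact: (fact_tag cd).
  by apply: link_typeof (link_role MO cd) => /=.
- have {}IHC d : d \in dom N -> sat N C d <-> sat (pt d).1 C (pt d).2.
    by apply: IHC => k kC; apply: sub; rewrite !inE kC !orbT.
  have Ccl : C \in cl by apply: sub; rewrite /= !inE mem_subconcepts !orbT.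
  have nCcl : CNot C \in cl by apply: sub; rewrite /= !inE eqxx orbT.
  have [MO _] := pt_model c.
  split=> [h d dM cd|h d dN /filtration_role[RSg _ _ [l _]]].
    have [u uN eu] := pt_full MO dM.
    apply/(typeof_sat eu Ccl)/IHC => //; apply: h => //.
    apply/filtration_role; split=> //; first exact: (fact_tag cd).
    by apply: link_typeof (link_role MO cd) => /=.
  (* Otherwise the link would yield an [R]-successor in [CNot C] inside the model of [pt c]. *)
  apply/IHC => //; apply: contrapT => ndC.
  have [h' _] := l (false, R) (CNot C) (mem_names RSg) (fun _ _ _ _ => id) nCcl.
  by have [k [ck]] := h' ndC; apply; apply: h => //; have [] := role_dom ck.
Qed.

(** Inclusions transfer from the model of each [pt c] by the truth lemma; role axioms are closure
    properties of [compat], applied to both halves of [link]. *)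
Lemma filtration_model : model N.
Proof.
apply/satisfiesP => phi phiO; have phiSg := fsubsetP (OSg phiO).
have MO M : model M -> valid M phi by move/satisfiesP; apply.
case: (Oshi phiO) => [[C [C' [e subC subC']]]|[R e]|[R [R' e]]|[R [R' e]]];
  rewrite {}e in phiSg MO *.
- apply/valid_ci => c cN /(filtration_sat subC cN) cC.
  apply/(filtration_sat subC' cN).
  have [cO cM] := pt_model c.
  exact: (valid_ci _ _ _).1 (MO _ cO) _ cM cC.
- have tr b : transitive (b, R).
    move=> M /MO/valid_trans h c d k; case: b => /=; last exact: h.
    by move=> dc kd; apply: h kd dc.
  apply/valid_trans => c d k /filtration_role[RSg cN dN [cd dc]].
  move=> /filtration_role[_ _ kN [dk kd]].
  apply/filtration_role; split=> //.
  have Rn : R \in names by apply: mem_names RSg.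
  have [cO _] := pt_model c; have [kO _] := pt_model k.
  by split; [apply: compat_trans cd dk|apply: compat_trans kd dc].
- have en b : entails (b, R) (b, R').
    by move=> M /MO/valid_sub h c d; case: b => /=; apply: h.
  apply/valid_sub => c d /filtration_role[RSg cN dN [cd dc]].
  apply/filtration_role; split=> //.
    by apply: phiSg; rewrite /= !inE eqxx orbT.
  by split; [apply: compat_entails cd|apply: compat_entails dc].
- have en b : entails (b, R) (~~ b, R').
    by move=> M /MO/valid_inv h c d; case: b => /=; apply h.
  have en' b : entails (~~ b, R') (b, R).
    by move=> M /MO/valid_inv h c d; case: b => /=; apply h.
  have RSg : role_name R \in Sg by apply: phiSg; rewrite /= !inE eqxx.
  have R'Sg : role_name R' \in Sg by apply: phiSg; rewrite /= !inE eqxx !orbT.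
  apply/valid_inv => c d; split=> /filtration_role[_ cN dN [cd dc]].
    apply/filtration_role; split=> //; split.
      exact: compat_entails (en true) dc.
    exact: compat_entails (en false) cd.
  apply/filtration_role; split=> //; split.
    exact: compat_entails (en' false) dc.
  exact: compat_entails (en' true) cd.
Qed.

End Filtration.

(** * The ALC-ontology over type names *)

Definition realized_conc (t : ctype) (A : nat) : Prop :=
  exists M c, [/\ model M, typeof M c = t & conc (inst M) A c].

Definition realized_role (t t' : ctype) (R : nat) : Prop :=
  exists M c d, [/\ model M, typeof M c = t, typeof M d = t' &
                    role (inst M) R c d].

Definition realized (t : ctype) : Prop :=
  exists M c, [/\ model M, c \in dom M & typeof M c = t].

(** Excluded middle turns a condition on types into a concept, so inclusions with a [CBot]
    right-hand side forbid unrealizable situations. *)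
Definition truth (P : Prop) : concept := if `[< P >] then CTop else CBot.

(** A sum bounds its summands, so [goal] exceeds every name of [Sg]; the [.+1] in [type_name] keeps
    type names above [goal]. *)
Definition goal : nat := (sumn names).+1.

Definition type_name (t : ctype) : nat := goal + (choice.pickle t).+1.

(** The trivial first inclusion puts [goal] into the signature. Then come coverage by realized
    types, derivation of [goal], and joint realizability at concept and role facts. *)
Definition alc_ontology (A : nat) : ontology :=
  ci (CName goal) CTop ::
  ci CTop (foldr COr CBot
    [seq CAnd (CName (type_name t)) (truth (realized t))
       | t <- enum {: ctype}]) ::
  [seq ci (CAnd (CName (type_name t)) (truth (realized_conc t A))) (CName goal)
     | t <- enum {: ctype}] ++
  [seq ci (CAnd (CName (type_name p.1)) (CName p.2))
          (truth (realized_conc p.1 p.2))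
     | p <- allpairs pair (enum {: ctype}) names] ++
  [seq ci (CAnd (CName (type_name p.1.1)) (CEx p.2 (CName (type_name p.1.2))))
          (truth (realized_role p.1.1 p.1.2 p.2))
     | p <- allpairs pair (enum {: ctype * ctype}) names].

Lemma names_goal A : A \in names -> A < goal.
Proof.
rewrite /goal ltnS; elim: names => //= B s IH.
rewrite inE => /orP[/eqP ->|/IH h].
  exact: leq_addr.
exact: leq_trans h (leq_addl _ _).
Qed.

Lemma type_name_inj t t' : type_name t = type_name t' -> t = t'.
Proof. by move/addnI => -[]; apply: (pcan_inj choice.pickleK). Qed.

Lemma sat_truth (S' : schema) (M : structure S') P c : sat M (truth P) c <-> P.
Proof. by rewrite /truth; case: asboolP => //=. Qed.

Lemma sat_foldr_or (S' : schema) (M : structure S') (s : seq concept) c :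
  sat M (foldr COr CBot s) c <-> exists2 C, C \in s & sat M C c.
Proof.
elim: s => [|C s IH] /=; first by split=> // -[].
rewrite IH; split=> [[cC|[C' C's cC']]|[C']].
- by exists C; rewrite ?inE ?eqxx.
- by exists C'; rewrite ?inE ?C's ?orbT.
- by rewrite inE => /orP[/eqP ->|]; [left|right; exists C'].
Qed.

Lemma Forall_map (I : eqType) (T : Type) (P : T -> Prop) (f : I -> T) s :
  List.Forall P (map f s) <-> forall i, i \in s -> P (f i).
Proof.
elim: s => [|j s IH] /=; first by split=> // _; constructor.
rewrite List.Forall_cons_iff IH; split=> [[Pj h] i|h].
  by rewrite inE => /orP[/eqP ->|/h].
by split=> [|i si]; apply: h; rewrite inE ?eqxx ?si ?orbT.
Qed.

Lemma alc_ontologyP A : ontology_in ALC (alc_ontology A).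
Proof.
rewrite /ontology_in /alc_ontology !List.Forall_cons_iff.
split; first by []. split; first by [].
by rewrite !List.Forall_app !Forall_map; do ?split.
Qed.

Lemma satisfies_alc_ontology A (S' : schema) (M : structure S') :
  satisfies M (alc_ontology A) <->
  [/\ forall c, c \in dom M ->
        exists t, conc (inst M) (type_name t) c /\ realized t,
      forall t c, conc (inst M) (type_name t) c -> realized_conc t A ->
        conc (inst M) goal c,
      forall t B c, B \in names -> conc (inst M) (type_name t) c ->
        conc (inst M) B c -> realized_conc t B &
      forall t t' R c d, R \in names -> conc (inst M) (type_name t) c ->
        conc (inst M) (type_name t') d -> role (inst M) R c d ->
        realized_role t t' R].
Proof.
rewrite /satisfies /alc_ontology !List.Forall_cons_iff !List.Forall_app.
rewrite !Forall_map -!/(valid _ _) !valid_ci; split.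
  case=> _ [h1 [h2 [h3 h4]]]; split.
  - move=> c cM.
    have /sat_foldr_or[_ /mapP[t _ ->] [tc /sat_truth rt]] := h1 c cM I.
    by exists t.
  - move=> t c tc rt; have /valid_ci h := h2 t (mem_enum _ _).
    by apply: (h c (conc_dom tc)); split=> //; apply/sat_truth.
  - move=> t B c Bn tc Bc.
    have /h3/valid_ci h : (t, B) \in allpairs pair (enum {: ctype}) names.
      by apply/allpairsP; exists (t, B); rewrite mem_enum.
    by apply/sat_truth/(h c (conc_dom tc)).
  - move=> t t' R c d Rn tc td cd.
    have /h4/valid_ci h :
        (t, t', R) \in allpairs pair (enum {: ctype * ctype}) names.
      by apply/allpairsP; exists (t, t', R); rewrite mem_enum.
    apply/sat_truth/(h c (conc_dom tc)); split=> //.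
    by exists d; split=> //; apply: conc_dom td.
case=> h1 h2 h3 h4; split; first by [].
split; [|split; [|split]].
- move=> c cM _; have [t [tc rt]] := h1 c cM; apply/sat_foldr_or.
  exists (CAnd (CName (type_name t)) (truth (realized t))).
    by apply: map_f; rewrite mem_enum.
  by split=> //; apply/sat_truth.
- by move=> t _; apply/valid_ci => c cM [tc /sat_truth]; apply: h2.
- move=> _ /allpairsP[[t B] [_ Bn ->]]; apply/valid_ci => c cM [tc Bc].
  exact/sat_truth/(h3 _ _ c).
- move=> _ /allpairsP[[[t t'] R] [_ Rn ->]].
  apply/valid_ci => c cM [tc [d [_ [cd td]]]].
  exact/sat_truth/(h4 _ _ _ c d).
Qed.

End Types.

Lemma In_map (I : eqType) (T : Type) (f : I -> T) s i :
  i \in s -> List.In (f i) (map f s).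
Proof.
elim: s => //= j s IH; rewrite inE => /orP[/eqP ->|/IH]; first by left.
by right.
Qed.

Lemma fsig_sig (O : ontology) (phi : sentence) :
  List.In phi O -> fsig phi `<=` sig O.
Proof.
rewrite /sig; elim: O => //= psi O IH; rewrite big_cons => -[->|/IH h].
  exact: fsubsetUl.
exact: fsubset_trans h (fsubsetUr _ _).
Qed.

Lemma shi_axiom_sub cl cl' phi :
  {subset cl <= cl'} -> shi_axiom cl phi -> shi_axiom cl' phi.
Proof.
move=> sub [[C [D [e h1 h2]]]|h|h|h];
  [apply: Or41|exact: Or42|exact: Or43|exact: Or44].
by exists C, D; split=> // E; [move/h1|move/h2]; apply: sub.
Qed.

Lemma shi_closure (O : ontology) : ontology_in SHI O ->
  exists cl, forall phi, List.In phi O -> shi_axiom cl phi.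
Proof.
elim=> [|phi {}O hphi _ [cl clO]]; first by exists [::].
have [cl' phicl'] : exists cl', shi_axiom cl' phi.
  case: hphi => [C D|R|R R'|R R'].
  - exists (subconcepts C ++ subconcepts D); apply: Or41; exists C, D.
    by split=> // E EC; rewrite mem_cat EC ?orbT.
  - by exists [::]; apply: Or42; exists R.
  - by exists [::]; apply: Or43; exists R, R'.
  - by exists [::]; apply: Or44; exists R, R'.
exists (cl' ++ cl) => psi [<-|/clO].
  by move: phicl'; apply: shi_axiom_sub => E EC; rewrite mem_cat EC.
by apply: shi_axiom_sub => E EC; rewrite mem_cat EC orbT.
Qed.

(** * Agreement of the two ontology-mediated queries *)

Section Equivalence.
Variables (S : schema) (O : ontology) (cl : seq concept) (A : nat).

Let Sg := S `|` sig O.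
Let O' := alc_ontology Sg O cl A.
Let S' := S `|` sig O'.

Hypothesis Oshi : forall phi, List.In phi O -> shi_axiom cl phi.
Hypothesis Acl : CName A \in cl.

Lemma goal_sig : concept_name (goal Sg) \in S'.
Proof.
rewrite inE; apply/orP; right.
have /fsubsetP -> // : fsig (ci (CName (goal Sg)) CTop) `<=` sig O'.
  by apply: fsig_sig; left.
by rewrite /= !inE eqxx.
Qed.

Lemma type_sig (t : ctype Sg cl) : concept_name (type_name t) \in S'.
Proof.
rewrite inE; apply/orP; right.
have /fsubsetP -> // : fsig (ci (CAnd (CName (type_name t))
    (truth (realized_conc O t A))) (CName (goal Sg))) `<=` sig O'.
  apply: fsig_sig; right; right; apply/List.in_app_iff; left.
  apply: (In_map (fun t => ci (CAnd (CName (type_name t))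
    (truth (realized_conc O t A))) (CName (goal Sg)))).
  by rewrite mem_enum.
by rewrite /= !inE eqxx.
Qed.

Lemma data_names (D : instance S) f : f \in facts D -> (tag f).1 \in names Sg.
Proof. by move/fact_tag => fS; apply: mem_names; rewrite inE fS. Qed.

(** Labelling the elements of [M] with their own types, over the data facts alone, gives a model of
    [O']. There [goal] holds at [c] only if the type of [c] in [M] contains [A]. *)
Lemma alc_sound (D : instance S) (M : structure Sg) c :
  model O M -> facts D `<=` facts (inst M) -> c \in adom D ->
  (forall M' : structure S', satisfies M' O' ->
     facts D `<=` facts (inst M') -> conc (inst M') (goal Sg) c) ->
  conc (inst M) A c.
Proof.
move=> MO /fsubsetP DM cD cert.
pose P (f : fact) := f \in facts D \/
  if val (tagged f) is [:: d] then
    (tag f).1 = type_name (typeof cl M d) \/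
    (tag f).1 = goal Sg /\ realized_conc O (typeof cl M d) A
  else False.
have [M' [domM' M'P]] := structure_exists S' P (dom_neq0 M).
have not_type t d :
    @Fact (concept_name (@type_name Sg cl t)) [tuple d] \notin facts D.
  by apply/negP => /data_names/names_goal /=; rewrite ltnNge leq_addr.
have not_goal d : @Fact (concept_name (goal Sg)) [tuple d] \notin facts D.
  by apply/negP => /data_names/names_goal /=; rewrite ltnn.
have typeP t d : conc (inst M') (type_name t) d -> t = typeof cl M d.
  case/M'P => _ _ []; first by rewrite (negPf (not_type _ _)).
  case=> [/type_name_inj //|[/= /eqP]].
  by rewrite /type_name -{2}[goal Sg]addn0 eqn_add2l.
have concP B d : B \in names Sg -> conc (inst M') B d -> conc (inst M) B d.
  move=> /names_goal Bg /M'P[_ _ [/DM //|[/= e|[/= e _]]]].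
    by move: Bg; rewrite e ltnNge leq_addr.
  by move: Bg; rewrite e ltnn.
have roleP R d k : role (inst M') R d k -> role (inst M) R d k.
  by move=> /M'P[_ _ [/DM //|]].
have mem1 d : d \in dom M -> {subset [:: d] <= dom M}.
  by move=> dM k; rewrite inE => /eqP ->.
have M'O' : satisfies M' O'.
  apply/satisfies_alc_ontology; split.
  - rewrite domM' => d dM; exists (typeof cl M d); split; last by exists M, d.
    apply/M'P; split; [exact: type_sig|exact (mem1 d dM)|by right; left].
  - move=> t d td r; have dM := conc_dom td; rewrite domM' in dM.
    apply/M'P; split; [exact: goal_sig|exact (mem1 d dM)|].
    by right; right; split=> //; rewrite -(typeP _ _ td).
  - move=> t B d Bn /typeP -> /(concP _ _ Bn) dB.
    by exists M, d.
  - move=> t t' R d k _ /typeP -> /typeP -> /roleP dk.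
    by exists M, d, k.
have DM' : facts D `<=` facts (inst M').
  apply/fsubsetP => f fD; apply/M'P; split; last by left.
    by rewrite inE (fact_tag fD).
  by move=> d; apply: fact_dom (DM _ fD).
case/M'P: (cert M' M'O' DM') => _ _ []; first by rewrite (negPf (not_goal _)).
case=> [/= /eqP|[_ [M0 [d [_ e dA]]]]].
  by rewrite /type_name -{1}[goal Sg]addn0 eqn_add2l.
exact: (typeof_sat e Acl).1 dA.
Qed.

(** The type names in [M'] choose a realized type for each data constant; the filtration built from
    them is a model of [O] containing the data. *)
Lemma alc_complete (D : instance S) (M' : structure S') c :
  satisfies M' O' -> facts D `<=` facts (inst M') -> c \in adom D ->
  (forall M : structure Sg, model O M ->
     facts D `<=` facts (inst M) -> conc (inst M) A c) ->
  conc (inst M') (goal Sg) c.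
Proof.
move=> /satisfies_alc_ontology[cover goalI data_conc data_role].
move=> /fsubsetP DM' cD cert.
have adomM' d : d \in adom D -> d \in dom M'.
  move=> /bigfcupP[f]; rewrite andbT inE => fD; apply: fact_dom.
  exact: DM'.
(* Constants from [b] on are free to represent the types. *)
pose b := (\max_(d <- adom D) d).+1.
have adom_b d : d \in adom D -> d < b.
  by move=> dD; rewrite ltnS; apply: (leq_bigmax_seq (F := id)).
pose e (t : ctype Sg cl) : const := (b + choice.pickle t)%N.
have /boolp.choice[pt ptP] : forall d, exists x : pointed Sg,
    [/\ model O x.1 /\ x.2 \in dom x.1,
        d \in adom D -> conc (inst M') (type_name (typeof cl x.1 x.2)) d &
        forall t, d = e t -> realized O t -> typeof cl x.1 x.2 = t].
  move=> d; have [dD|dD] := boolP (d \in adom D).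
    have [t [td [M [k [MO kM kt]]]]] := cover d (adomM' d dD).
    exists (M, k); split=> //= [_|t' dt']; first by rewrite kt.
    by have := adom_b d dD; rewrite dt' ltnNge leq_addr.
  have [[t [dt [M [k [MO kM kt]]]]]|nt] :=
      pselect (exists t, d = e t /\ realized O t).
    exists (M, k); split=> //= t'; rewrite dt => /addnI.
    by move/(pcan_inj choice.pickleK) => <-.
  (* All other constants get a default pointed model, taken from [c]. *)
  have [t [_ [M [k [MO kM kt]]]]] := cover c (adomM' c cD).
  exists (M, k); split=> //= t' dt' rt'; case: nt; by exists t'.
(* Unrealized types get a constant too; its pointed model is a default one, so its actual type is
   still realized. *)
pose X := adom D `|` [fset e t | t in {: ctype Sg cl}].
have X0 : X != fset0 by apply/fset0Pn; exists c; rewrite inE cD.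
have [N [domN NP]] :=
  structure_exists Sg (filtration_fact O cl (facts D) pt) X0.
rewrite -domN in NP.
have DN : facts D `<=` facts (inst N).
  apply/fsubsetP => f fD; apply/NP; split; last by left.
    by rewrite inE (fact_tag fD).
  move=> d df; rewrite domN inE; apply/orP; left.
  by apply/bigfcupP; exists f; rewrite ?fD ?inE.
have Dadom f d : f \in facts D -> d \in val (tagged f) -> d \in adom D.
  by move=> fD df; apply/bigfcupP; exists f; rewrite ?fD ?inE.
have D_conc B d : @Fact (concept_name B) [tuple d] \in facts D ->
    realized_conc O (typeof cl (pt d).1 (pt d).2) B.
  move=> dB; have [_ td _] := ptP d.
  apply: (data_conc _ B d (data_names dB)); last exact: DM'.
  by apply/td/(Dadom _ _ dB); rewrite inE.
have OSg phi : List.In phi O -> fsig phi `<=` Sg.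
  by move/fsig_sig => h; apply: fsubset_trans h (fsubsetUr _ _).
have pt_full M d : model O M -> d \in dom M ->
    exists2 u, u \in dom N & typeof cl (pt u).1 (pt u).2 = typeof cl M d.
  move=> MO dM; exists (e (typeof cl M d)).
    by rewrite domN inE in_imfset ?orbT.
  by have [_ _] := ptP (e (typeof cl M d)); apply=> //; exists M, d.
have cN : c \in dom N by rewrite domN inE cD.
have NO : model O N.
  apply: (filtration_model OSg Oshi _ pt_full _ _ NP) => // [d|R d k dk].
    by have [] := ptP d.
  have [_ td _] := ptP d; have [_ tk _] := ptP k.
  apply: (data_role _ _ R d k (data_names dk)); last exact: DM'.
    by apply/td/(Dadom _ _ dk); rewrite !inE eqxx.
  by apply/tk/(Dadom _ _ dk); rewrite !inE eqxx orbT.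
have [[cO cM] tc _] := ptP c.
(* [A] holds at [c] in [N], hence at [pt c], which realizes the type that [M'] assigns to [c]. *)
apply: goalI (tc cD) _; exists (pt c).1, (pt c).2; split=> //.
exact: (filtration_conc D_conc NP Acl cN).1 (cert N NO DN).
Qed.

End Equivalence.

(** * The two inclusions between the languages *)

Theorem theorem4 :
  same_expressive_power binary (omq_language ALC AQ) (omq_language SHI AQ).
Proof.
split=> S n q _ [O {}q HO Hq].
  move: Hq => [A _]; have [cl clO] := shi_closure HO.
  (* Types must also decide the queried name, which may not occur in [O]. *)
  pose cl' := CName A :: cl.
  have Acl' : CName A \in cl' by rewrite inE eqxx.
  have cl'O phi : List.In phi O -> shi_axiom cl' phi.
    by move/clO; apply: shi_axiom_sub => C Ccl; rewrite inE Ccl orbT.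
  exists (omq (atomic (S `|` sig (alc_ontology (S `|` sig O) O cl' A))
                      (goal (S `|` sig O)))).
  split.
    by apply: Omq; [exact: alc_ontologyP|constructor; exact: goal_sig].
  move=> D a; have [c ->] : exists c, a = [tuple c].
    by case/tupleP: a => c t; exists c; rewrite [t]tuple0; apply/val_inj.
  split=> -[sub cert]; split=> // M MO DM.
    apply: (alc_complete cl'O Acl' MO DM) => //.
    by apply: sub; rewrite inE.
  apply: (alc_sound Acl' MO DM) => //.
  by apply: sub; rewrite inE.
(* Every ALC-ontology is already a SHI-ontology. *)
exists (omq q); split; last by [].
apply: Omq Hq; apply: List.Forall_impl HO => _ [C D]; exact: SHI_ci.
Qed.
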